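(* If the OWA weights are nonincreasing, i.e. $w_1\ge w_2\ge\dots\ge w_K$, and $\mathcal{P}$ is polynomially solvable, then $\textsc{Min-Owa}~\mathcal{P}$ is approximable within $w_1K$, where $K$ is the number of scenarios.
   Context: A combinatorial optimization problem $\mathcal{P}$: each instance specifies a finite set of elements $E=\{e_1,\dots,e_n\}$, a set of feasible solutions $\Phi\subseteq 2^E$ (typically described implicitly), and a nonnegative cost $c_i$ for each $e_i\in E$; one seeks $X\in\Phi$ minimizing $\sum_{e_i\in X}c_i$. $\mathcal{P}$ is polynomially solvable if an optimal solution can be computed in polynomial time for all nonnegative costs. Uncertain version: instead of a single cost vector one is given a scenario set $\Gamma=\{\pmb{c}_1,\dots,\pmb{c}_K\}$ of $K$ distinct cost scenarios $\pmb{c}_j=(c_{1j},\dots,c_{nj})$ with nonnegative entries ($K$ may be part of the input), and $F(X,\pmb{c}_j)=\sum_{e_i\in X}c_{ij}$. For a weight vector $\pmb{w}=(w_1,\dots,w_K)$ with $w_j\in[0,1]$ and $\sum_j w_j=1$, let $$\mathrm{OWA}(X)=\sum_{j=1}^K w_jF(X,\pmb{c}_{\sigma(j)}),$$ where $\sigma$ is a permutation of $\{1,\dots,K\}$ with $F(X,\pmb{c}_{\sigma(1)})\ge\dots\ge F(X,\pmb{c}_{\sigma(K)})$. $\textsc{Min-Owa}~\mathcal{P}$ is the problem $\min_{X\in\Phi}\mathrm{OWA}(X)$. A minimization problem is approximable within $\rho$ if there is a polynomial-time algorithm that on each instance returns a feasible solution whose objective value is at most $\rho$ times the optimal value. *)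

(* Defs.v *)
From HB Require Import structures.
From mathcomp Require Import all_boot all_order all_fingroup all_algebra.

Set Implicit Arguments.
Unset Strict Implicit.
Unset Printing Implicit Defensive.

Import Order.TTheory GRing.Theory Num.Theory.

(** * Computations

    The machine model is that of while-programs acting on finitely many stacks
    over a fixed finite alphabet; pushing, popping and testing the top of a
    stack take one time unit each.  A stack is half a tape and a finite control
    is a program, so these programs and deterministic multitape Turing machines
    simulate each other with at most a constant-factor slowdown (for a fixed
    program or machine). *)

Variant letter := Bit of bool | Comma | Semicolon.

(** A test reads only the top letter of a stack ([None] if it is empty), so
    that [T] is a finite table. *)
Inductive program :=
  | Skip
  | Push (x : nat) (a : letter)
  | Pop (x : nat)
  | Seq (c1 c2 : program)
  | If (x : nat) (T : option letter -> bool) (c1 c2 : program)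
  | While (x : nat) (T : option letter -> bool) (c : program).

Definition store := nat -> seq letter.

Definition upd (s : store) (x : nat) (u : seq letter) : store :=
  fun y => if y == x then u else s y.

(** [exec c s s' t]: started in [s], the program [c] halts in [s'] after [t]
    time units. *)
Inductive exec : program -> store -> store -> nat -> Prop :=
  | exec_skip s : exec Skip s s 1
  | exec_push x a s : exec (Push x a) s (upd s x (a :: s x)) 1
  | exec_pop x s : exec (Pop x) s (upd s x (behead (s x))) 1
  | exec_seq c1 c2 s s1 s2 t1 t2 :
      exec c1 s s1 t1 -> exec c2 s1 s2 t2 -> exec (Seq c1 c2) s s2 (t1 + t2)
  | exec_if x (T : option letter -> bool) c1 c2 s s' t :
      exec (if T (ohead (s x)) then c1 else c2) s s' t ->
      exec (If x T c1 c2) s s' t.+1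
  | exec_while_stop x (T : option letter -> bool) c s :
      ~~ T (ohead (s x)) -> exec (While x T c) s s 1
  | exec_while_step x (T : option letter -> bool) c s s1 s2 t1 t2 :
      T (ohead (s x)) -> exec c s s1 t1 -> exec (While x T c) s1 s2 t2 ->
      exec (While x T c) s s2 (t1 + t2).+1.

(** Stack 0 serves both for input and output, the first letter of the word
    being on top; the other stacks are initially empty and their final contents
    are ignored. *)
Definition computes (c : program) (u v : seq letter) (t : nat) : Prop :=
  exists2 s', exec c (upd (fun _ => [::]) 0 u) s' t & s' 0%N = v.

(** * Encodings *)

(** Binary digits, least significant first, without superfluous zeros: in
    particular [bits 0 = [::]]. *)
Definition bits (n : nat) : seq bool :=
  mkseq (fun i => odd (n %/ 2 ^ i)) (up_log 2 n.+1).

(** Nonnegative rational numbers as they are given to an algorithm: a pair of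
    natural numbers, not necessarily coprime. *)
Record frac := Frac { num : nat; den : nat; den_gt0 : 0 < den }.

Definition fval (q : frac) : rat := ((num q)%:R / (den q)%:R)%R.

Definition enc_nat (n : nat) : seq letter := rcons (map Bit (bits n)) Comma.

Definition enc_frac (q : frac) : seq letter := enc_nat (num q) ++ enc_nat (den q).

Definition enc_list (T : Type) (enc : T -> seq letter) (s : seq T) : seq letter :=
  rcons (flatten (map enc s)) Semicolon.

(** The characteristic vector of a set of elements. *)
Definition enc_set (n : nat) (X : {set 'I_n}) : seq letter :=
  [seq Bit (i \in X) | i <- enum 'I_n].

(** * Minimization problems and approximability *)

Local Open Scope ring_scope.

Record minimization := Minimization {
  input : Type;
  encode : input -> seq letter;
  ground : input -> nat;
  solutions : forall I : input, {set {set 'I_(ground I)}};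
  objective : forall I : input, {set 'I_(ground I)} -> rat
}.

Definition optimal (Q : minimization) (I : input Q) (X : {set 'I_(ground I)}) :=
  X \in solutions I /\
  forall Y, Y \in solutions I -> objective X <= objective Y.

Definition returns_within (Q : minimization) (c : program) (p : {poly nat})
    (I : input Q) (X : {set 'I_(ground I)}) : Prop :=
  exists2 t, computes c (encode I) (enc_set X) t
           & (t <= p.[size (encode I)])%N.

Definition solvable_in_polytime (Q : minimization) : Prop :=
  exists (c : program) (p : {poly nat}), forall I : input Q,
  exists2 X : {set 'I_(ground I)}, optimal X & returns_within c p X.

(** The ratio [rho] may depend on the instance. *)
Definition approximable_within (Q : minimization) (rho : input Q -> rat) : Prop :=
  exists (c : program) (p : {poly nat}), forall I : input Q,
  exists X : {set 'I_(ground I)},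
    [/\ X \in solutions I,
        returns_within c p X
      & forall Xopt : {set 'I_(ground I)}, optimal Xopt ->
          objective X <= rho I * objective Xopt].

Definition restrict (Q : minimization) (A : input Q -> Prop) : minimization :=
  @Minimization {I : input Q | A I}
    (fun I => encode (sval I)) (fun I => ground (sval I))
    (fun I => solutions (sval I)) (fun I X => objective X).

(** * Combinatorial optimization problems *)

(** A [structure] is an instance without its costs (e.g. a graph with two
    terminals), given to algorithms by the word [describe s]; the elements are
    numbered from 0.  An instance has at least one feasible solution. *)
Record comb_problem := CombProblem {
  structure : Type;
  describe : structure -> seq bool;
  nelem : structure -> nat;
  feasible : forall s : structure, {set {set 'I_(nelem s)}};
  feasible_neq0 : forall s : structure, feasible s != set0
}.

Definition total_cost (n : nat) (c : 'I_n -> rat) (X : {set 'I_n}) : rat :=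
  \sum_(i in X) c i.

Record cost_input (P : comb_problem) := CostInput {
  cost_structure : structure P;
  cost : 'I_(nelem cost_structure) -> frac
}.

Definition min_cost (P : comb_problem) : minimization :=
  @Minimization (cost_input P)
    (fun I => rcons (map Bit (describe (cost_structure I))) Semicolon ++
              enc_list enc_frac [seq cost i | i <- enum 'I_(nelem (cost_structure I))])
    (fun I => nelem (cost_structure I))
    (fun I => feasible (cost_structure I))
    (fun I X => total_cost (fun i => fval (cost i)) X).

Definition polynomially_solvable (P : comb_problem) : Prop :=
  solvable_in_polytime (min_cost P).

(** * The OWA criterion *)

Definition nonincreasing (K : nat) (f : 'I_K -> rat) : bool :=
  [forall j : 'I_K, forall k : 'I_K, (j <= k)%N ==> (f k <= f j)].

(** [owa_sortable] shows that the default case never occurs, and [owaE] that the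
    value does not depend on the chosen permutation. *)
Definition owa (K : nat) (w f : 'I_K -> rat) : rat :=
  if [pick s : 'S_K | nonincreasing (fun j => f (s j))] is Some s
  then \sum_(j < K) w j * f (s j) else 0.

Lemma nonincreasingP (K : nat) (f : 'I_K -> rat) :
  reflect (forall j k : 'I_K, (j <= k)%N -> f k <= f j) (nonincreasing f).
Proof.
apply: (iffP forallP) => [H j k jk | H j].
  by move/forallP: (H j) => /(_ k) /implyP; apply.
by apply/forallP => k; apply/implyP; apply: H.
Qed.

Lemma nonincreasing_sorted (K : nat) (f : 'I_K -> rat) :
  nonincreasing f = sorted (fun x y => y <= x) [seq f j | j <- enum 'I_K].
Proof.
have tr : transitive (fun x y : rat => y <= x) by move=> y x z yx zy; apply: le_trans yx.
have sz : size [seq f j | j <- enum 'I_K] = K by rewrite size_map size_enum_ord.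
have nthf (j : 'I_K) : nth 0 [seq f j | j <- enum 'I_K] j = f j.
  by rewrite (nth_map j) ?size_enum_ord // nth_ord_enum.
apply/nonincreasingP/idP => [H | H j k jk].
  apply/(sortedP 0) => i; rewrite sz => iK.
  by rewrite (nthf (Ordinal (ltnW iK))) (nthf (Ordinal iK)); apply: H => /=.
rewrite -(nthf j) -(nthf k).
by apply: (sorted_leq_nth tr (fun x => lexx x)) => //; rewrite inE sz.
Qed.

Lemma owa_sortable (K : nat) (f : 'I_K -> rat) :
  exists s : 'S_K, nonincreasing (fun j => f (s j)).
Proof.
pose r (x y : rat) := y <= x.
have tot : total r by move=> x y; apply: le_total.
have : perm_eq (sort r [seq f j | j <- enum 'I_K]) [tuple f j | j < K].
  by rewrite perm_sort.
case/tuple_permP => s Es; exists s.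
rewrite nonincreasing_sorted.
have -> : [seq f (s j) | j <- enum 'I_K] = sort r [seq f j | j <- enum 'I_K].
  by rewrite Es; apply: eq_map => j; rewrite tnth_mktuple.
exact: sort_sorted.
Qed.

Lemma owaE (K : nat) (w f : 'I_K -> rat) (s : 'S_K) :
  nonincreasing (fun j => f (s j)) -> owa w f = \sum_(j < K) w j * f (s j).
Proof.
rewrite /owa; case: pickP => [s' Hs' Hs | H]; last by rewrite H.
have E : [seq f (s' j) | j <- enum 'I_K] = [seq f (s j) | j <- enum 'I_K].
  rewrite !nonincreasing_sorted in Hs Hs'.
  apply: (sorted_eq _ _ Hs' Hs).
  - by move=> y x z yx zy; apply: le_trans yx.
  - by move=> x y /andP[yx xy]; apply/le_anti/andP.
  - have en (u : 'S_K) : perm_eq [seq u j | j <- enum 'I_K] (enum 'I_K).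
      apply: uniq_perm; [|exact: enum_uniq|].
        by rewrite map_inj_uniq; [exact: enum_uniq | exact: perm_inj].
      move=> j; rewrite mem_enum inE; apply/mapP.
      by exists (u^-1%g j); rewrite ?mem_enum ?permKV.
    rewrite (map_comp f s') (map_comp f s); apply: perm_map.
    by rewrite (perm_trans (en s')) // perm_sym.
apply: eq_bigr => j _; congr (_ * _).
by have /eq_in_map/(_ j) := E; apply; rewrite mem_enum.
Qed.

(** [scenario_cost i j] is the cost of element [i] under scenario [j]. *)
Record owa_input (P : comb_problem) := OwaInput {
  owa_structure : structure P;
  nscen : nat;
  nscen_gt0 : (0 < nscen)%N;
  weight : 'I_nscen -> frac;
  weight_le1 : forall j, fval (weight j) <= 1;
  weight_sum : \sum_(j < nscen) fval (weight j) = 1;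
  scenario_cost : 'I_(nelem owa_structure) -> 'I_nscen -> frac;
  scenarios_distinct :
    injective (fun j => [ffun i => fval (scenario_cost i j)])
}.

(** The number of scenarios, the weights and the matrix of costs, row by row,
    are all part of the input. *)
Definition min_owa (P : comb_problem) : minimization :=
  @Minimization (owa_input P)
    (fun I => rcons (map Bit (describe (owa_structure I))) Semicolon ++
              enc_list enc_frac [seq weight j | j <- enum 'I_(nscen I)] ++
              enc_list (fun i => enc_list enc_frac
                                   [seq scenario_cost i j | j <- enum 'I_(nscen I)])
                       (enum 'I_(nelem (owa_structure I))))
    (fun I => nelem (owa_structure I))
    (fun I => feasible (owa_structure I))
    (fun I X => owa (fun j => fval (weight j))
                    (fun j => total_cost (fun i => fval (scenario_cost i j)) X)).

Definition nonincreasing_weights (P : comb_problem) (I : input (min_owa P)) : Prop :=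
  nonincreasing (fun j => fval (@weight P I j)).

Definition first_weight (P : comb_problem) (I : owa_input P) : rat :=
  fval (weight (Ordinal (nscen_gt0 I))).

(* Main.v *)
(** The algorithm ignores the weights and minimizes the total cost of a set over
    all scenarios.  If X is optimal for the summed costs then, for every feasible
    Y, OWA(X) <= w_1 (sum_j F(X, c_j)) <= w_1 (sum_j F(Y, c_j)) <= w_1 K OWA(Y):
    the first step bounds each weight by w_1, the last one is Chebyshev's sum
    inequality for the nonincreasing sequences w_j and F(Y, c_sigma(j)), the
    weights having sum 1.

    On the machine, a row of fractions a/b is added up in binary by
    N/D + a/b = (N b + a D) / (D b): the digits of a, then those of b, are read
    once, least significant first, while the shifted multiples of N and D are
    accumulated.  No number gets longer than the part of the row read so far, so
    that every letter of the input costs linear time. *)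
Require Import Defs.
From HB Require Import structures.
From mathcomp Require Import all_boot all_order all_fingroup all_algebra.
From mathcomp Require Import zify ring.
From Stdlib Require Import FunctionalExtensionality.

Set Implicit Arguments.
Unset Strict Implicit.
Unset Printing Implicit Defensive.

Import Order.TTheory GRing.Theory Num.Theory.

(* [all_algebra] exports another [frac]. *)
Local Notation frac := Defs.frac.

(** * Running times of programs *)

(** Times are only bounded from above, whereas [exec] counts exactly, so estimates can be rounded at
    every step. *)
Definition runs (c : program) (s s' : store) (T : nat) : Prop :=
  exists2 t, exec c s s' t & t <= T.

Lemma runs_le c s s' T T' : T <= T' -> runs c s s' T -> runs c s s' T'.
Proof. by move=> TT' [t e tT]; exists t => //; apply: leq_trans TT'. Qed.

Lemma runs_seq c1 c2 s s1 s2 t1 t2 T : runs c1 s s1 t1 -> runs c2 s1 s2 t2 ->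
  t1 + t2 <= T -> runs (Seq c1 c2) s s2 T.
Proof.
move=> [u1 e1 h1] [u2 e2 h2] h; exists (u1 + u2); last by lia.
exact: exec_seq e1 e2.
Qed.

Lemma runs_cat c1 c2 s s1 s2 t1 t2 : runs c1 s s1 t1 -> runs c2 s1 s2 t2 ->
  runs (Seq c1 c2) s s2 (t1 + t2).
Proof. by move=> h1 h2; apply: runs_seq h1 h2 (leqnn _). Qed.

Lemma runs_while_stop x (T : option letter -> bool) c s :
  ~~ T (ohead (s x)) -> runs (While x T c) s s 1.
Proof. by move=> h; exists 1 => //; apply: exec_while_stop. Qed.

Lemma runs_while_step x (T : option letter -> bool) c s s1 s2 t1 t2 t :
  T (ohead (s x)) -> runs c s s1 t1 -> runs (While x T c) s1 s2 t2 ->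
  t1 + t2 < t -> runs (While x T c) s s2 t.
Proof.
move=> h [u1 e1 h1] [u2 e2 h2] ht; exists (u1 + u2).+1; last by lia.
exact: exec_while_step e1 e2.
Qed.

Lemma runs_if x (T : option letter -> bool) c1 c2 s s' t :
  runs (if T (ohead (s x)) then c1 else c2) s s' t -> runs (If x T c1 c2) s s' t.+1.
Proof. by move=> [u e h]; exists u.+1; [apply: exec_if|]. Qed.

(** Each time unit pushes at most one letter. The length of a computed word is thus bounded by the
    time spent on it. *)
Lemma exec_size c s s' t x : exec c s s' t -> size (s' x) <= size (s x) + t.
Proof.
elim=> {c s s' t}; rewrite /upd //=; intros; try case: eqP => [->|_] /=;
  rewrite ?size_behead; lia.
Qed.

(** * Loop-free programs *)

Fixpoint straight (c : program) : bool :=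
  match c with
  | Seq c1 c2 | If _ _ c1 c2 => straight c1 && straight c2
  | While _ _ _ => false
  | _ => true
  end.

Fixpoint eval (c : program) (s : store) : store :=
  match c with
  | Push x a => upd s x (a :: s x)
  | Pop x => upd s x (behead (s x))
  | Seq c1 c2 => eval c2 (eval c1 s)
  | If x T c1 c2 => if T (ohead (s x)) then eval c1 s else eval c2 s
  | _ => s
  end.

(** A time bound for loop-free programs; a test is charged for both branches, which avoids a
    maximum. *)
Fixpoint program_size (c : program) : nat :=
  match c with
  | Seq c1 c2 => program_size c1 + program_size c2
  | If _ _ c1 c2 => (program_size c1 + program_size c2).+1
  | _ => 1
  end.

Lemma runs_straight c s : straight c -> runs c s (eval c s) (program_size c).
Proof.
elim: c s => [|x a|x|c1 IH1 c2 IH2|x T c1 IH1 c2 IH2|//] s /=.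
- by move=> _; exists 1 => //; apply: exec_skip.
- by move=> _; exists 1 => //; apply: exec_push.
- by move=> _; exists 1 => //; apply: exec_pop.
- by case/andP => sc1 sc2; apply: runs_cat (IH1 _ sc1) (IH2 _ sc2).
case/andP => /(IH1 s) h1 /(IH2 s) h2.
have [t e ht] : runs (if T (ohead (s x)) then c1 else c2) s
    (if T (ohead (s x)) then eval c1 s else eval c2 s)
    (program_size c1 + program_size c2).
  by case: ifP => _; [apply: runs_le h1|apply: runs_le h2]; lia.
by exists t.+1; [apply: exec_if|].
Qed.

Lemma runs_eval c s s' T : straight c -> eval c s = s' -> program_size c <= T ->
  runs c s s' T.
Proof. by move=> sc <- h; apply: runs_le h _; apply: runs_straight. Qed.

Definition nonempty (o : option letter) : bool := o.
Definition is_bit o := if o is Some (Bit _) then true else false.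
Definition is_true_bit o := if o is Some (Bit true) then true else false.
Definition is_false_bit o := if o is Some (Bit false) then true else false.
Definition in_list o :=
  match o with Some (Bit _) | Some Comma => true | _ => false end.
Definition is_comma o := if o is Some Comma then true else false.

(** * Discarding and moving letters *)

Definition drop_while (T : option letter -> bool) (x : nat) := While x T (Pop x).

Lemma runs_drop_while (T : option letter -> bool) x s u v : s x = u ++ v ->
  all (fun a => T (Some a)) u -> ~~ T (ohead v) ->
  runs (drop_while T x) s (upd s x v) (2 * size u + 1).
Proof.
elim: u s => [|a u IH] s /= sx.
  move=> _ h; have -> : upd s x v = s.
    by apply: functional_extensionality => z; rewrite /upd; case: eqP => // ->.
  by apply: runs_while_stop; rewrite sx.
case/andP=> Ta Tu h; apply: (runs_while_step (t1 := 1) (t2 := 2 * size u + 1)).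
- by rewrite sx.
- exact: runs_eval.
- have -> : upd s x v = upd (eval (Pop x) s) x v.
    by apply: functional_extensionality => z; rewrite /= /upd; case: eqP.
  by apply: IH => //; rewrite /= /upd eqxx sx.
by lia.
Qed.

(** [Push] has a fixed letter, so copying the top letter takes a case distinction over the
    alphabet. *)
Definition move_letter (x y : nat) :=
  Seq (If x is_true_bit (Push y (Bit true))
      (If x is_false_bit (Push y (Bit false))
      (If x is_comma (Push y Comma) (Push y Semicolon)))) (Pop x).

Definition move_while (T : option letter -> bool) (x y : nat) :=
  While x T (move_letter x y).

Lemma runs_move_while (T : option letter -> bool) x y s u v : x != y ->
  s x = u ++ v -> all (fun a => T (Some a)) u -> ~~ T (ohead v) ->
  runs (move_while T x y) s (upd (upd s x v) y (catrev u (s y))) (9 * size u + 1).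
Proof.
move=> xy; elim: u s => [|a u IH] s /= sx.
  move=> _ h; have -> : upd (upd s x v) y (s y) = s.
    apply: functional_extensionality => z; rewrite /upd.
    by case: eqP => [->|_] //; case: eqP => // ->.
  by apply: runs_while_stop; rewrite sx.
case/andP=> Ta Tu h.
have ev : eval (move_letter x y) s = upd (upd s x (u ++ v)) y (a :: s y).
  apply: functional_extensionality => z; rewrite /= sx /=.
  case: a {Ta sx} (sx) => [[]| |] sx /=; rewrite /upd (negbTE xy) sx /=;
    by case: (eqVneq z x) => [->|//]; rewrite (negbTE xy).
(* The 8 is the [program_size] of [move_letter x y]; the loop test makes it 9 per letter. *)
apply: (runs_while_step (t1 := 8) (t2 := 9 * size u + 1)).
- by rewrite sx.
- by apply: runs_eval ev _.
- have -> : upd (upd s x v) y (catrev u (a :: s y)) =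
     upd (upd (upd (upd s x (u ++ v)) y (a :: s y)) x v) y
       (catrev u (upd (upd s x (u ++ v)) y (a :: s y) y)).
    apply: functional_extensionality => z; rewrite /upd eqxx.
    by case: (eqVneq z y) => // zy; case: (eqVneq z x).
  by apply: IH => //; rewrite /= /upd eqxx (negbTE xy).
by lia.
Qed.

Lemma runs_move x y s : x != y ->
  runs (move_while nonempty x y) s
    (upd (upd s x [::]) y (catrev (s x) (s y))) (9 * size (s x) + 1).
Proof.
by move=> xy; apply: runs_move_while; rewrite ?cats0 ?all_predT.
Qed.

(** * Binary numbers *)

Fixpoint bval (l : seq bool) : nat := if l is b :: l' then b + (bval l').*2 else 0.

Lemma bitsS n : 0 < n -> bits n = odd n :: bits n./2.
Proof.
move=> n0; rewrite /bits up_log2S // /mkseq /= expn0 divn1.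
congr (_ :: _); rewrite -[1]addn0 iotaDl -map_comp; apply: eq_map => i /=.
by rewrite add1n expnS divnMA divn2.
Qed.

Lemma bvalK n : bval (bits n) = n.
Proof.
elim/ltn_ind: n => -[|n] IH; first by rewrite /bits.
by rewrite bitsS //= IH ?odd_double_half //; lia.
Qed.

(** A nonempty word whose most significant digit is 1 has positive value, so [bitsS] peels off its
    digits one by one. The default [true] admits the empty word, which stands for 0. *)
Lemma bits_bval l : last true l -> bits (bval l) = l.
Proof.
elim: l => [|b l IH]; first by rewrite /bits.
rewrite [last _ _]/= => h; have v0 : 0 < bval (b :: l).
  elim: (l) (b) h => [|b' l' IHl] b0 /=; first by case: b0.
  by move=> /IHl /=; lia.
rewrite bitsS //= oddD odd_double oddb addbF halfD odd_double doubleK oddb.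
rewrite andbF (_ : b./2 = 0) ?IH //; first by case: (l) h.
by case: (b).
Qed.

Lemma bval_cat_nseq l k : bval (l ++ nseq k false) = bval l.
Proof.
by elim: l => [|b l /= ->] //=; elim: k => //= k ->.
Qed.

Lemma trailing_zerosP (v : seq bool) :
  exists2 l, last true l & exists k, v = l ++ nseq k false.
Proof.
elim/last_ind: v => [|v b [l hl [k ->]]]; first by exists [::] => //; exists 0.
case: b.
  exists (rcons (l ++ nseq k false) true); first by rewrite last_rcons.
  by exists 0; rewrite cats0.
exists l => //; exists k.+1.
by rewrite -cats1 -catA -(nseqD k 1) addn1.
Qed.

Definition word (l : seq bool) : seq letter := map Bit l.

(** * Adding fractions on stacks *)

(** One column of binary addition as a table. Once [y] is empty its digit counts as 0: [is_true_bit]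
    fails on [None], and popping an empty stack changes nothing. *)
Definition add_step (x y : nat) :=
  Seq (If x is_true_bit
        (Seq (Push 7 (Bit true))
          (If y is_true_bit
            (If 9 nonempty (Push 8 (Bit true))
              (Seq (Push 8 (Bit false)) (Push 9 (Bit true))))
            (If 9 nonempty (Push 8 (Bit false)) (Push 8 (Bit true)))))
        (Seq (Push 7 (Bit false))
          (If y is_true_bit
            (If 9 nonempty (Push 8 (Bit false)) (Push 8 (Bit true)))
            (If 9 nonempty (Seq (Push 8 (Bit true)) (Pop 9))
              (Push 8 (Bit false))))))
    (Seq (Pop x) (Pop y)).

(** Used when [x] is exhausted: a carry turns digits 1 into 0 until it is absorbed by a 0 or by the
    end of [y]. The digits of [y] beyond that point stay in place. *)
Definition carry_step (y : nat) :=
  Seq (If y is_true_bit (Push 8 (Bit false)) (Seq (Push 8 (Bit true)) (Pop 9)))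
    (Pop y).

(** Adds the number on stack [x] to the one on stack [y]: stack 7 keeps the
    letters read on [x], stack 8 receives the digits of the sum, and stack 9 is
    nonempty when there is a carry. *)
Definition add_stacks (x y : nat) :=
  Seq (While x nonempty (add_step x y))
 (Seq (While 9 nonempty (carry_step y))
 (Seq (move_while nonempty 8 y) (move_while nonempty 7 x))).

Section Addition.

Variables (x y : nat) (s : store).
Hypotheses (xy : x != y) (x7 : x < 7) (y7 : y < 7).

(** Only these five stacks change during an addition: the summands, the letters read on [x], the
    digits of the sum, and the carry. *)
Let S (u v a b k : seq letter) : store := fun z =>
  if z == x then u else if z == y then v else
  if z == 7 then a else if z == 8 then b else if z == 9 then k else s z.

Let carry (c : bool) : seq letter := nseq c (Bit true).

Let neqs : ((y == x) = false) * ((x == y) = false) *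
  ((7 == x) = false) * ((8 == x) = false) * ((9 == x) = false) *
  ((7 == y) = false) * ((8 == y) = false) * ((9 == y) = false) *
  ((x == 7) = false) * ((x == 8) = false) * ((x == 9) = false) *
  ((y == 7) = false) * ((y == 8) = false) * ((y == 9) = false).
Proof. by do !split; lia. Qed.

Let add_stepE (d c : bool) u v a b :
  eval (add_step x y) (S (word (d :: u)) (word v) a b (carry c)) =
  S (word u) (word (behead v)) (Bit d :: a)
    (Bit (d (+) head false v (+) c) :: b)
    (carry (d + head false v + c >= 2)).
Proof.
apply: functional_extensionality => z.
case: d; case: c; case: v => [|[] v]; do 4! rewrite /= /S /upd /= ?neqs ?eqxx;
  by move=> /=; do 5 (case: eqVneq => [e|_] /=; rewrite ?e ?neqs //).
Qed.

Let carry_stepE v a b :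
  eval (carry_step y) (S [::] (word v) a b (carry true)) =
  S [::] (word (behead v)) a (Bit (~~ head false v) :: b) (carry (head false v)).
Proof.
apply: functional_extensionality => z.
case: v => [|[] v]; do 4! rewrite /= /S /upd /= ?neqs ?eqxx;
  by move=> /=; do 5 (case: eqVneq => [e|_] /=; rewrite ?e ?neqs //).
Qed.

Let S9 u v a b k : S u v a b k 9 = k.
Proof. by rewrite /S !neqs. Qed.

Let S8 u v a b k : S u v a b k 8 = b.
Proof. by rewrite /S !neqs. Qed.

Let S7 u v a b k : S u v a b k 7 = a.
Proof. by rewrite /S !neqs. Qed.

Let Sx u v a b k : S u v a b k x = u.
Proof. by rewrite /S eqxx. Qed.

Let Sy u v a b k : S u v a b k y = v.
Proof. by rewrite /S neqs eqxx. Qed.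

(** Here [o] consists of the digits written while the carry lives and [v'] is the untouched rest of
    [v]; the sum is longer than [v] only if the carry survives all of [v]. *)
Let runs_carry c v a b : exists o v',
  [/\ runs (While 9 nonempty (carry_step y)) (S [::] (word v) a b (carry c))
        (S [::] (word v') a (catrev (word o) b) [::]) (6 * size v + 7),
      bval (o ++ v') = c + bval v & size (o ++ v') <= size v + c].
Proof.
have stop v1 b1 T : 0 < T -> runs (While 9 nonempty (carry_step y))
    (S [::] (word v1) a b1 [::]) (S [::] (word v1) a b1 [::]) T.
  by move=> h; apply: runs_le h _; apply: runs_while_stop; rewrite S9.
have step v1 b1 s2 T : runs (While 9 nonempty (carry_step y))
      (S [::] (word (behead v1)) a (Bit (~~ head false v1) :: b1)
         (carry (head false v1))) s2 T ->
    runs (While 9 nonempty (carry_step y)) (S [::] (word v1) a b1 (carry true))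
      s2 (T + 6).
  move=> h; apply: runs_while_step h _; first by rewrite S9.
    by apply: runs_eval (carry_stepE _ _ _) (leqnn _).
  by rewrite /=; lia.
case: c; last by exists [::], v; split; [apply: stop; lia| |rewrite /=; lia].
elim: v b => [|[] v IH] b.
- exists [:: true], [::]; split=> //.
  by apply: runs_le (step _ _ _ 1 _) => //; apply: stop.
- have [o [v' [h val sz]]] := IH (Bit false :: b).
  exists (false :: o), v'; split; [|by rewrite /= val; lia|by move: sz => /=; lia].
  by apply: runs_le (step (true :: v) b _ _ h); rewrite /=; lia.
- exists [:: true], v; split=> //; last by rewrite /=; lia.
  by apply: runs_le (step (false :: v) b _ 1 _); [rewrite /=; lia|apply: stop].
Qed.

(** The last clause expresses the value without powers of 2: [r] stands for the digits that the
    carry loop will supply. *)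
Let runs_digits c u v a b : exists o v' c',
  [/\ runs (While x nonempty (add_step x y))
         (S (word u) (word v) a b (carry c))
         (S [::] (word v') (catrev (word u) a) (catrev (word o) b) (carry c'))
         (22 * size u + 1),
      size o = size u, size v' = size v - size u
    & forall r, bval r = c' + bval v' ->
        bval (o ++ r) = c + bval u + bval v].
Proof.
elim: u c v a b => [|d u IH] c v a b.
  exists [::], v, c; split=> //; [|exact: esym (subn0 _)|by move=> r ->; rewrite addn0].
  by apply: runs_while_stop; rewrite Sx.
have [o [v' [c' [h so sv val]]]] := IH (2 <= d + head false v + c) (behead v)
  (Bit d :: a) (Bit (d (+) head false v (+) c) :: b).
exists (d (+) head false v (+) c :: o), v', c'; split=> [| | |r /val /= ->].
- apply: runs_while_step h _; first by rewrite Sx.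
    by apply: runs_eval (add_stepE _ _ _ _ _ _) (leqnn _).
  by rewrite /=; lia.
- by rewrite /= so.
- by rewrite sv size_behead /=; lia.
by case: v {IH h val sv} => [|e v] /=; case: d; case: c => //=; try case: e => /=; lia.
Qed.

(** Stack 8 holds the new digits most significant on top, so moving them onto the rest of [y] puts
    them in order; moving stack 7 back restores [x]. *)
Lemma runs_add u v : s x = word u -> s y = word v ->
  s 7 = [::] -> s 8 = [::] -> s 9 = [::] ->
  exists v',
  [/\ runs (add_stacks x y) s (upd s y (word v')) (60 * (size u + size v + 1)),
      bval v' = bval u + bval v & size v' <= maxn (size u) (size v) + 1].
Proof.
move=> sx sy s7 s8 s9.
have [o1 [v1 [c1 [h1 so1 sv1 val1]]]] := runs_digits false u v [::] [::].
have [o2 [v2 [h2 val2 so2]]] := runs_carry c1 v1 (catrev (word u) [::])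
  (catrev (word o1) [::]).
have Es : s = S (word u) (word v) [::] [::] (carry false).
  apply: functional_extensionality => z; rewrite /S.
  by do 5 (case: eqVneq => [->|_] //).
exists (o1 ++ o2 ++ v2); split; last 2 first.
- by rewrite (val1 _ val2).
- by move: so2; rewrite !size_cat so1; case: (c1) => /=; lia.
set s3 := S [::] (word v2) _ _ _ in h2.
have n8 : 8 != y by rewrite neqs.
have n7 : 7 != x by rewrite neqs.
have h3 := @runs_move 8 y s3 n8.
set s4 := upd _ y _ in h3.
have h4 := @runs_move 7 x s4 n7.
have s38 : s3 8 = rev (word (o1 ++ o2)).
  by rewrite /s3 S8 !catrevE cats0 /word map_cat rev_cat.
have s47 : s4 7 = rev (word u).
  by rewrite /s4 /upd !neqs /s3 S7 catrevE cats0.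
suff -> : upd s y (word (o1 ++ o2 ++ v2)) =
    upd (upd s4 7 [::]) x (catrev (s4 7) (s4 x)).
  rewrite [X in runs _ X]Es; apply: (runs_seq h1); first apply: (runs_seq h2).
  - exact: runs_seq h3 h4 (leqnn _).
  - exact: leqnn.
  move: so2; rewrite s38 s47 !size_rev !size_map !size_cat so1.
  by move: (leq_b1 c1); lia.
have s4x : s4 x = [::] by rewrite /s4 /upd !neqs /s3 Sx.
rewrite s47 s4x catrevE cats0 revK /s4 s38 [s3 y]Sy catrevE revK /word -map_cat -catA.
apply: functional_extensionality => z; rewrite /s3 /S /upd.
by do 5 (case: eqVneq => [e|?] /=; rewrite ?e ?neqs //).
Qed.

End Addition.

(** Superfluous zeros are dropped, as [bits] has none. *)
Definition emit (x : nat) :=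
  Seq (move_while nonempty x 7) (Seq (drop_while is_false_bit 7)
 (Seq (move_while nonempty 7 x) (Seq (move_while nonempty x 1) (Push 1 Comma)))).

Lemma runs_emit x s v : x != 7 -> x != 1 -> s x = word v -> s 7 = [::] ->
  runs (emit x) s (upd (upd s x [::]) 1 (catrev (enc_nat (bval v)) (s 1)))
    (40 * (size v + 1)).
Proof.
move=> x7 x1 sx s7; have [l hl [k ev]] := trailing_zerosP v.
have h1 := @runs_move x 7 s x7.
set s1 := upd _ 7 _ in h1.
have s17 : s1 7 = nseq k (Bit false) ++ rev (word l).
  rewrite /s1 /upd eqxx s7 sx catrevE cats0 ev /word map_cat rev_cat map_nseq.
  by rewrite rev_nseq.
have h2 : runs (drop_while is_false_bit 7) s1 (upd s1 7 (rev (word l))) (2 * k + 1).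
  rewrite -[k in 2 * k](size_nseq k (Bit false)).
  apply: runs_drop_while s17 _ _; first by rewrite all_nseq orbT.
  by case/lastP: (l) hl => // l' b; rewrite last_rcons /word map_rcons rev_rcons => ->.
have n7 : 7 != x by rewrite eq_sym.
have n1 : 1 != x by rewrite eq_sym.
have h3 := @runs_move 7 x (upd s1 7 (rev (word l))) n7.
set s3 := upd _ x _ in h3.
have h4 := @runs_move x 1 s3 x1.
move/negbTE: n7 => x7'; move/negbTE: n1 => x1'.
have s3x : s3 x = word l.
  by rewrite /s3 /s1 /upd !eqxx (negbTE x7) catrevE revK cats0.
apply: (runs_seq h1); first apply: (runs_seq h2); first apply: (runs_seq h3);
  first apply: (runs_seq h4).
- apply: runs_eval (leqnn _) => //; apply: functional_extensionality => z.
  rewrite /= [upd _ 1 _ 1]/upd eqxx s3x ev bval_cat_nseq /enc_nat bits_bval //.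
  rewrite !catrevE rev_rcons /s3 /s1 /upd !eqxx /=.
  by do 3 (case: eqVneq => [e|?] /=; rewrite ?e ?x1' ?x7' //).
- exact: leqnn.
- exact: leqnn.
- exact: leqnn.
rewrite s3x sx ev /upd eqxx !size_rev /word !size_map size_cat size_nseq /=; lia.
Qed.

(** Stacks beyond the list are empty. With such stores, the effect of a program on concrete stacks
    reduces by computation. *)
Definition st (l : seq (seq letter)) : store := nth [::] l.

Lemma upd_st l x u : upd (st l) x u = st (set_nth [::] l x u).
Proof.
by apply: functional_extensionality => z; rewrite /st nth_set_nth.
Qed.

(** At most seven listed stacks leave the scratch stacks 7, 8 and 9 empty, as [runs_add]
    requires. *)
Lemma runs_add_st x y l u v : x != y -> x < 7 -> y < 7 -> size l <= 7 ->
  nth [::] l x = word u -> nth [::] l y = word v ->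
  exists v', [/\ runs (add_stacks x y) (st l) (st (set_nth [::] l y (word v')))
      (60 * (size u + size v + 1)),
    bval v' = bval u + bval v & size v' <= maxn (size u) (size v) + 1].
Proof.
move=> xy x7 y7 sl lx ly.
have scratch i : 7 <= i -> st l i = [::] by move=> ?; rewrite /st nth_default //; lia.
have [v' [h1 h2 h3]] := runs_add xy x7 y7 lx ly (scratch 7 isT) (scratch 8 isT)
  (scratch 9 isT).
by exists v'; rewrite -upd_st.
Qed.

(** Stack 0 holds the input, stack 1 the reversed output, stacks 2 and 3 the
    numerator N and the denominator D of the current sum, stacks 4 and 5 their new
    values, and stack 6 the shifted copies of D needed to read a numerator. *)
Definition read_num :=
  While 0 is_bit
    (Seq (If 0 is_true_bit (add_stacks 6 4) Skip)
    (Seq (Pop 0) (Push 6 (Bit false)))).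

Definition read_den :=
  While 0 is_bit
    (Seq (If 0 is_true_bit (Seq (add_stacks 2 4) (add_stacks 3 5)) Skip)
    (Seq (Pop 0) (Seq (Push 2 (Bit false)) (Push 3 (Bit false))))).

(** Schoolbook multiplication: pushing a zero at the least significant end doubles [u], which is
    added to [v] at each digit 1 of [a]. The length bound [m] grows by one per digit; the fixed [M]
    serves the time estimate. *)
Lemma runs_read_num a i o n d d' u v m M :
  size u <= m -> size v <= m -> m + size a <= M ->
  exists u' v',
  [/\ runs read_num
        (st [:: word a ++ Comma :: i; o; n; d; word v; d'; word u])
        (st [:: Comma :: i; o; n; d; word v'; d'; word u'])
        (size a * (120 * M + 70) + 1),
      bval v' = bval v + bval a * bval u,
      size v' <= m + size a & size u' <= m + size a].
Proof.
elim: a u v m => [|b a IH] u v m hu hv hm.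
  by exists u, v; split; rewrite ?addn0 //; apply: runs_while_stop.
rewrite /= in hm.
have [w [h1 valw hw]] : exists w,
    [/\ runs (If 0 is_true_bit (add_stacks 6 4) Skip)
          (st [:: word (b :: a) ++ Comma :: i; o; n; d; word v; d'; word u])
          (st [:: word (b :: a) ++ Comma :: i; o; n; d; word w; d'; word u])
          (120 * M + 61),
        bval w = b * bval u + bval v & size w <= m.+1].
  case: b {IH}.
    have [w [h valw sw]] := @runs_add_st 6 4
      [:: word (true :: a) ++ Comma :: i; o; n; d; word v; d'; word u] u v
      isT isT isT isT erefl erefl.
    exists w; split; [|by rewrite valw mul1n|lia].
    by apply: runs_le (runs_if (t := 60 * (size u + size v + 1)) _) => //; lia.
  exists v; split=> //; last by lia.
  by apply: runs_le (runs_if (t := 1) _); [lia|apply: runs_eval].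
have [u' [v' [h2 val' sv' su']]] := IH (false :: u) w m.+1 hu hw ltac:(lia).
exists u', v'; split; [|rewrite val' valw /=; lia|rewrite /=; lia|rewrite /=; lia].
apply: runs_while_step h2 _ => //.
  by apply: (runs_seq h1 (runs_eval _ _ (leqnn _))) (leqnn _); rewrite //= !upd_st.
by rewrite /=; lia.
Qed.

(** The same multiplication for numerator and denominator at once. Stack 4 already contains the
    product from [read_num], hence its separate length bound [k]. *)
Lemma runs_read_den a i o t u v u' v' m k M :
  size u <= m -> size v <= m -> size u' <= k -> size v' <= m ->
  m <= k -> k + size a <= M ->
  exists x y x' y',
  [/\ runs read_den
        (st [:: word a ++ Comma :: i; o; word u; word v; word u'; word v'; t])
        (st [:: Comma :: i; o; word x; word y; word x'; word y'; t])
        (size a * (240 * M + 140) + 1),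
      [/\ bval x' = bval u' + bval a * bval u & bval y' = bval v' + bval a * bval v],
      [/\ size x <= m + size a & size y <= m + size a]
    & [/\ size x' <= k + size a & size y' <= m + size a]].
Proof.
elim: a u v u' v' m k => [|b a IH] u v u' v' m k hu hv hu' hv' mk hk.
  exists u, v, u', v'; rewrite !addn0; split=> //.
  by apply: runs_while_stop.
rewrite /= in hk.
have [w [w' [h1 [valw valw'] [hw hw']]]] : exists w w',
    [/\ runs (If 0 is_true_bit (Seq (add_stacks 2 4) (add_stacks 3 5)) Skip)
      (st [:: word (b :: a) ++ Comma :: i; o; word u; word v; word u'; word v'; t])
      (st [:: word (b :: a) ++ Comma :: i; o; word u; word v; word w; word w'; t])
      (240 * M + 121),
      [/\ bval w = b * bval u + bval u' & bval w' = b * bval v + bval v']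
    & [/\ size w <= k.+1 & size w' <= m.+1]].
  case: b {IH}.
    have [w [h valw sw]] := @runs_add_st 2 4
      [:: word (true :: a) ++ Comma :: i; o; word u; word v; word u'; word v'; t]
      u u' isT isT isT isT erefl erefl.
    have [w' [h' valw' sw']] := @runs_add_st 3 5
      [:: word (true :: a) ++ Comma :: i; o; word u; word v; word w; word v'; t]
      v v' isT isT isT isT erefl erefl.
    exists w, w'; split; [|by rewrite valw valw' !mul1n|lia].
    apply: runs_le (runs_if (t := 240 * M + 120) _); first by lia.
    by apply: runs_seq h h' _; lia.
  exists u', v'; split=> //; last by lia.
  by apply: runs_le (runs_if (t := 1) _); [lia|apply: runs_eval].
have [x [y [x' [y' [h2 [val val'] [sx sy] [sx' sy']]]]]] :=
  IH (false :: u) (false :: v) w w' m.+1 k.+1 hu hv hw hw' mk ltac:(lia).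
exists x, y, x', y'; split;
  [|by split; rewrite ?val ?val' ?valw ?valw' /=; lia|rewrite /=; lia|rewrite /=; lia].
apply: runs_while_step h2 _ => //.
  by apply: (runs_seq h1 (runs_eval _ _ (leqnn _))) (leqnn _); rewrite //= !upd_st.
by rewrite /=; lia.
Qed.

(** Adding to an empty stack serves as copying: the denominator goes to stack 6 at the start, the
    new values return to stacks 2 and 3 at the end. *)
Definition frac_step :=
  Seq (add_stacks 3 6) (Seq read_num (Seq (Pop 0) (Seq (drop_while nonempty 6)
 (Seq read_den (Seq (Pop 0)
 (Seq (drop_while nonempty 2) (Seq (add_stacks 4 2) (Seq (drop_while nonempty 4)
 (Seq (drop_while nonempty 3) (Seq (add_stacks 5 3)
   (drop_while nonempty 5))))))))))).

Lemma runs_clear_st x l v : nth [::] l x = word v ->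
  runs (drop_while nonempty x) (st l) (st (set_nth [::] l x [::]))
    (2 * size v + 1).
Proof.
rewrite -upd_st -(size_map Bit) => lx.
by apply: runs_drop_while; rewrite ?cats0 // all_predT.
Qed.

Lemma runs_pop_st x l :
  runs (Pop x) (st l) (st (set_nth [::] l x (behead (nth [::] l x)))) 1.
Proof. by rewrite -upd_st; apply: runs_eval. Qed.

(** A copy made by addition is only known to be at most one digit longer than the original. Two such
    copies affect the numerator, and the two commas of [enc_frac q] make up for these digits. *)
Lemma runs_frac_step q i o u v m M :
  size u <= m -> size v <= m -> m + size (enc_frac q) <= M ->
  exists u' v',
  [/\ runs frac_step
        (st [:: enc_frac q ++ i; o; word u; word v; [::]; [::]; [::]])
        (st [:: i; o; word u'; word v'; [::]; [::]; [::]])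
        (size (enc_frac q) * (240 * M + 240)),
      bval u' = bval u * den q + num q * bval v, bval v' = bval v * den q,
      size u' <= m + size (enc_frac q) & size v' <= m + size (enc_frac q)].
Proof.
move=> hu hv; have -> : enc_frac q ++ i =
    word (bits (num q)) ++ Comma :: (word (bits (den q)) ++ Comma :: i).
  by rewrite /enc_frac /enc_nat -catA !cat_rcons.
rewrite /enc_frac /enc_nat size_cat !size_rcons !(size_map Bit) => hM.
set a := bits (num q) in hM *; set b := bits (den q) in hM *.
have [t [h1 valt st1]] := @runs_add_st 3 6
  [:: word a ++ Comma :: word b ++ Comma :: i; o; word u; word v; [::]; [::]; [::]]
  v [::] isT isT isT isT erefl erefl.
rewrite /= maxn0 in st1.
have st1' : size t <= m.+1 by lia.
have hM1 : m.+1 + size a <= M by lia.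
have hM2 : m.+1 + size a + size b <= M by lia.
have hm : m <= m.+1 + size a by lia.
have [t' [n [h2 valn sn st2]]] := @runs_read_num a (word b ++ Comma :: i) o
  (word u) (word v) [::] t [::] m.+1 M st1' isT hM1.
have [x [y [x' [y' [h3 [valx valy] [sx sy] [sx' sy']]]]]] :=
  @runs_read_den b i o [::] u v n [::] m (m.+1 + size a) M hu hv sn isT hm hM2.
have [u' [h4 valu' su']] := @runs_add_st 4 2
  [:: i; o; [::]; word y; word x'; word y'; [::]] x' [::]
  isT isT isT isT erefl erefl.
have [v' [h5 valv' sv']] := @runs_add_st 5 3
  [:: i; o; word u'; [::]; [::]; word y'; [::]] y' [::]
  isT isT isT isT erefl erefl.
rewrite /= in su' sv'.
have ea : bval a = num q by apply: bvalK.
have eb : bval b = den q by apply: bvalK.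
exists u', v'; split.
- apply: runs_le; last first.
    apply: (runs_cat h1); apply: (runs_cat h2); apply: (runs_cat (runs_pop_st _ _)).
    apply: runs_cat; first by apply: (runs_clear_st (v := t')).
    apply: (runs_cat h3); apply: (runs_cat (runs_pop_st _ _)).
    apply: runs_cat; first by apply: (runs_clear_st (v := x)).
    apply: (runs_cat h4).
    apply: runs_cat; first by apply: (runs_clear_st (v := x')).
    apply: runs_cat; first by apply: (runs_clear_st (v := y)).
    apply: (runs_cat h5).
    by apply: (runs_clear_st (v := y')).
  have ha : size a * (120 * M + 70) <= size a * (240 * M + 240).
    by apply: leq_mul => //; lia.
  have hb : size b * (240 * M + 140) <= size b * (240 * M + 240).
    by apply: leq_mul => //; lia.
  (* The shares of the two commas are split off; they pay for the copies and for clearing stacks. *)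
  rewrite [leqRHS]mulnDl (mulSn (size a)) (mulSn (size b)).
  by rewrite /=; lia.
- by rewrite valu' valx valn valt ea eb /=; lia.
- by rewrite valv' valy eb /=; lia.
- by move: su' sx'; rewrite maxn0; lia.
- by move: sv' sy'; rewrite maxn0; lia.
Qed.

(** * Sums of rows of fractions *)

Lemma frac_add_den_gt0 (p q : frac) : 0 < den p * den q.
Proof. by rewrite muln_gt0 !den_gt0. Qed.

(** Left unreduced, as the machine produces it without computing a gcd. *)
Definition frac_add (p q : frac) : frac :=
  Frac (num p * den q + num q * den p) (frac_add_den_gt0 p q).

Definition frac_sum (r : seq frac) : frac := foldl frac_add (@Frac 0 1 isT) r.

Lemma enc_list_cons (T : Type) (enc : T -> seq letter) x s :
  enc_list enc (x :: s) = enc x ++ enc_list enc s.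
Proof. by rewrite /enc_list /= rcons_cat. Qed.

Lemma enc_nat_head n u : exists a w, [/\ enc_nat n ++ u = a :: w & in_list (Some a)].
Proof.
rewrite /enc_nat; case: (bits n) => [|b l] /=.
  by exists Comma, u.
by exists (Bit b), (rcons (map Bit l) Comma ++ u).
Qed.

Lemma enc_frac_head q u : exists a w, [/\ enc_frac q ++ u = a :: w & in_list (Some a)].
Proof. by rewrite /enc_frac -catA; apply: enc_nat_head. Qed.

Lemma in_list_enc_frac q : all (fun a => in_list (Some a)) (enc_frac q).
Proof.
by rewrite /enc_frac /enc_nat all_cat !all_rcons !all_map /= !all_predT.
Qed.

Definition sum_row :=
  Seq (Push 3 (Bit true)) (Seq (While 0 in_list frac_step)
 (Seq (Pop 0) (Seq (emit 2) (emit 3)))).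

Lemma size_enc_frac_ge2 q : 2 <= size (enc_frac q).
Proof. by rewrite size_cat !size_rcons; lia. Qed.

Lemma runs_fracs r i o p u v m M :
  size u <= m -> size v <= m -> m + size (flatten (map enc_frac r)) <= M ->
  bval u = num p -> bval v = den p ->
  exists u' v',
  [/\ runs (While 0 in_list frac_step)
        (st [:: enc_list enc_frac r ++ i; o; word u; word v; [::]; [::]; [::]])
        (st [:: Semicolon :: i; o; word u'; word v'; [::]; [::]; [::]])
        (size (flatten (map enc_frac r)) * (240 * M + 241) + 1),
      bval u' = num (foldl frac_add p r), bval v' = den (foldl frac_add p r),
      size u' <= M & size v' <= M].
Proof.
elim: r p u v m => [|q r IH] p u v m hu hv hm eu ev.
  exists u, v; split=> //; try lia.
  by apply: runs_while_stop.
rewrite /= size_cat in hm.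
have hM1 : m + size (enc_frac q) <= M by lia.
have [u1 [v1 [h1 eu1 ev1 su1 sv1]]] :=
  runs_frac_step (enc_list enc_frac r ++ i) o hu hv hM1.
have [|||u' [v' [h2 eu' ev' su' sv']]] := IH (frac_add p q) u1 v1 _ su1 sv1.
- by rewrite -addnA.
- by rewrite eu1 eu ev.
- by rewrite ev1 ev.
exists u', v'; split=> //.
rewrite enc_list_cons -catA; apply: runs_while_step h1 h2 _.
  by have [a [w [-> ha]]] := enc_frac_head q (enc_list enc_frac r ++ i).
(* As a fraction has at least one letter, raising 240 to 241 per letter pays for the loop test. *)
have := size_enc_frac_ge2 q.
by rewrite /= size_cat mulnDl; lia.
Qed.

Lemma upd_st0 (u : seq letter) : upd (fun _ => [::]) 0 u = st [:: u].
Proof. by apply: functional_extensionality => -[|[|z]]. Qed.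

Lemma st_nil7 i o : st [:: i; o; [::]; [::]; [::]; [::]; [::]] = st [:: i; o].
Proof. by apply: functional_extensionality => -[|[|[|[|[|[|[|[|z]]]]]]]]. Qed.

Lemma runs_sum_row r i o M : size (enc_list enc_frac r) <= M ->
  runs sum_row (st [:: enc_list enc_frac r ++ i; o])
    (st [:: i; catrev (enc_frac (frac_sum r)) o])
    (size (enc_list enc_frac r) * (240 * M + 241)).
Proof.
rewrite size_rcons => hM.
(* The initial sum is 0/1. Its longest entry has one digit, so [m] is 1, which the closing
   [Semicolon] makes up for in [hM]. *)
have [u [v [h1 eu ev su sv]]] :=
  @runs_fracs r i o (@Frac 0 1 isT) [::] [:: true] 1 M isT isT hM erefl erefl.
have h0 : runs (Push 3 (Bit true)) (st [:: enc_list enc_frac r ++ i; o])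
   (st [:: enc_list enc_frac r ++ i; o; [::]; word [:: true]; [::]; [::]; [::]]) 1.
  by rewrite -st_nil7; apply: runs_eval => //=; rewrite upd_st.
have h2 := @runs_emit 2 (st [:: i; o; word u; word v; [::]; [::]; [::]]) u
  isT isT erefl erefl.
have h3 := @runs_emit 3
  (st [:: i; catrev (enc_nat (bval u)) o; [::]; word v; [::]; [::]; [::]]) v
  isT isT erefl erefl.
rewrite !upd_st /= in h2 h3.
rewrite -(st_nil7 i) [enc_frac (frac_sum r)]/enc_frac catrev_catl -eu -ev.
apply: (runs_seq h0); first apply: (runs_seq h1);
  first apply: (runs_seq (runs_pop_st _ _));
  first apply: (runs_seq h2 h3); try exact: leqnn.
(* The share of the [Semicolon] pays for emitting two numbers of length at most [M]. *)
by rewrite [leqRHS]mulSn; lia.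
Qed.

(** * From a matrix of scenario costs to a single cost vector *)

Definition collect :=
  Seq (move_while in_list 0 1) (Seq (Seq (Pop 0) (Push 1 Semicolon))
 (Seq (drop_while in_list 0) (Seq (Pop 0) (Seq (While 0 in_list sum_row)
   (Seq (Pop 0) (Push 1 Semicolon)))))).

(** The output is collected in reverse, and the move restores its order. Keeping [collect] separate
    lets its running time bound the length of the word to be moved. *)
Definition aggregate := Seq collect (move_while nonempty 1 0).

(** Rows must be nonempty: an empty one would be encoded by [Semicolon] alone, and the loop would
    take it for the end of the matrix. *)
Lemma runs_rows rs i o M : all (fun r => 0 < size r) rs ->
  size (enc_list (enc_list enc_frac) rs) <= M ->
  runs (While 0 in_list sum_row)
    (st [:: enc_list (enc_list enc_frac) rs ++ i; o])
    (st [:: Semicolon :: i; catrev (flatten [seq enc_frac (frac_sum r) | r <- rs]) o])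
    (size (enc_list (enc_list enc_frac) rs) * (240 * M + 242)).
Proof.
elim: rs o => [|r rs IH] o; first move=> _ _.
  apply: (@runs_le _ _ _ 1); first by rewrite /=; lia.
  exact: runs_while_stop.
case/andP=> r0 rs0; rewrite enc_list_cons size_cat => hM.
have h1 := @runs_sum_row r (enc_list (enc_list enc_frac) rs ++ i) o M ltac:(lia).
have h2 := IH (catrev (enc_frac (frac_sum r)) o) rs0 ltac:(lia).
rewrite /= catrev_catl -catA.
apply: runs_while_step h1 h2 _.
  case: r r0 {hM} => // q r _; rewrite enc_list_cons -catA.
  by have [a [w [-> ha]]] := enc_frac_head q
    (enc_list enc_frac r ++ (enc_list (enc_list enc_frac) rs ++ i)).
have : 0 < size (enc_list enc_frac r) by rewrite size_rcons.
by rewrite mulnDl; lia.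
Qed.

Lemma enc_list_map (T U : Type) (enc : U -> seq letter) (f : T -> U) s :
  enc_list enc (map f s) = enc_list (enc \o f) s.
Proof. by rewrite /enc_list -map_comp. Qed.

Lemma runs_aggregate (d : seq bool) (ws : seq frac) (rs : seq (seq frac)) :
  all (fun r => 0 < size r) rs ->
  let i := rcons (word d) Semicolon ++ enc_list enc_frac ws ++
           enc_list (enc_list enc_frac) rs in
  runs aggregate (st [:: i])
    (st [:: rcons (word d) Semicolon ++ enc_list enc_frac (map frac_sum rs)])
    (3000 * (size i).+1 ^ 2).
Proof.
move=> rs0; set r := enc_list _ rs; set w := enc_list _ ws => /=.
set i := _ ++ _; set M := size i.
have sM : M = size d + 1 + size w + size r.
  by rewrite /M !size_cat size_rcons size_map; lia.
set o1 := rev (word d).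
have h1 : runs (move_while in_list 0 1) (st [:: i]) (st [:: Semicolon :: w ++ r; o1])
    (9 * size (word d) + 1).
  have := @runs_move_while in_list 0 1 (st [:: i]) (word d) (Semicolon :: w ++ r) isT.
  rewrite !upd_st /= catrevE cats0; apply=> //; first by rewrite -cat_rcons.
  by rewrite all_map all_predT.
have h2 : runs (Seq (Pop 0) (Push 1 Semicolon)) (st [:: Semicolon :: w ++ r; o1])
    (st [:: w ++ r; Semicolon :: o1]) 2.
  by apply: runs_eval => //=; rewrite !upd_st.
have h3 : runs (drop_while in_list 0) (st [:: w ++ r; Semicolon :: o1])
    (st [:: Semicolon :: r; Semicolon :: o1]) (2 * size w + 1).
  have := @runs_drop_while in_list 0 (st [:: w ++ r; Semicolon :: o1])
    (flatten (map enc_frac ws)) (Semicolon :: r).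
  rewrite upd_st /w /enc_list cat_rcons => /(_ erefl _ isT) h.
  apply: runs_le (h _); first by rewrite size_rcons; lia.
  by elim: (ws) => //= q qs IH; rewrite all_cat IH andbT; apply: in_list_enc_frac.
have h4 := runs_pop_st 0 [:: Semicolon :: r; Semicolon :: o1].
have hr : size r <= M by lia.
have := @runs_rows rs [::] (Semicolon :: o1) M rs0 hr.
rewrite cats0 -/r; set o2 := catrev _ _ => h5.
have h6 : runs (Seq (Pop 0) (Push 1 Semicolon)) (st [:: [:: Semicolon]; o2])
    (st [:: [::]; Semicolon :: o2]) 2.
  by apply: runs_eval => //=; rewrite !upd_st.
have h7 := @runs_move 1 0 (st [:: [::]; Semicolon :: o2]) isT.
set o := _ ++ enc_list _ _.
have eo : catrev (Semicolon :: o2) [::] = o.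
  by rewrite catrevE cats0 /o2 /o /o1 /enc_list catrevE rev_cons rev_cat revK
     rev_cons revK -map_comp rcons_cat.
have h8 : runs collect (st [:: i]) (st [:: [::]; Semicolon :: o2]) (290 * M.+1 ^ 2).
  apply: (runs_seq h1); first apply: (runs_seq h2);
  first apply: (runs_seq h3); first apply: (runs_seq h4);
  first apply: (runs_seq h5 h6); try exact: leqnn.
  have : size r * (240 * M + 242) <= M * (240 * M + 242).
    by rewrite leq_pmul2r; lia.
  by rewrite size_map -mulnn; lia.
have -> : st [:: o] = upd (upd (st [:: [::]; Semicolon :: o2]) 1 [::]) 0
    (catrev (Semicolon :: o2) [::]).
  by rewrite eo !upd_st; apply: functional_extensionality => -[|[|[|z]]].
(* By [exec_size] the word to be moved has length at most [290 * M.+1 ^ 2]. Moving costs 9 units per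
   letter and one more, so the total is at most [2900 * M.+1 ^ 2 + 1]. *)
have [t e ht] := h8; apply: runs_seq h8 h7 _.
have so : size (Semicolon :: o2) <= 0 + t := exec_size 1 e.
rewrite (_ : st _ 1 = Semicolon :: o2) //.
have : 0 < M.+1 ^ 2 by rewrite expn_gt0.
by move: ht so; set q := size _; set X := M.+1 ^ 2 => ht so X0; lia.
Qed.

(** * Total costs and the OWA criterion *)

Local Open Scope ring_scope.

(** The products [(w j - w k) * (f j - f k)] are nonnegative since both factors have the same sign;
    summed over all pairs they give twice the difference of the two sides. *)
Lemma chebyshev_sum (K : nat) (w f : 'I_K -> rat) :
  nonincreasing w -> nonincreasing f ->
  (\sum_j w j) * (\sum_j f j) <= K%:R * \sum_j w j * f j.
Proof.
move=> /nonincreasingP hw /nonincreasingP hf.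
have h : 0 <= \sum_j \sum_k (w j - w k) * (f j - f k).
  apply: sumr_ge0 => j _; apply: sumr_ge0 => k _.
  case: (leqP j k) => jk.
    by apply: mulr_ge0; rewrite subr_ge0; [apply: hw|apply: hf].
  by apply: mulr_le0; rewrite subr_le0; [apply: hw|apply: hf]; apply: ltnW.
have e : \sum_j \sum_k (w j - w k) * (f j - f k) =
    (K%:R * (\sum_j w j * f j) - (\sum_j w j) * (\sum_j f j)) *+ 2.
  transitivity (\sum_j \sum_k (w j * f j + w k * f k - (w j * f k + w k * f j))).
    by apply: eq_bigr => j _; apply: eq_bigr => k _; ring.
  under eq_bigr do rewrite sumrB !big_split /= sumr_const card_ord.
  rewrite sumrB !big_split /= sumr_const card_ord sumrMnl -(mulr_natl _ K).
  under [X in _ - (X + _)]eq_bigr do rewrite -mulr_sumr.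
  under [X in _ - (_ + X)]eq_bigr do rewrite -mulr_suml.
  rewrite -mulr_suml -mulr_sumr; ring.
by move: h; rewrite e pmulrn_lge0 // subr_ge0.
Qed.

Lemma fval_ge0 (q : frac) : 0 <= fval q.
Proof. by rewrite /fval divr_ge0 ?ler0n. Qed.

Lemma fval_add (p q : frac) : fval (frac_add p q) = fval p + fval q.
Proof.
have [dp dq] : (den p)%:R != 0 :> rat /\ (den q)%:R != 0 :> rat.
  by rewrite !pnatr_eq0 -!lt0n !den_gt0.
by rewrite /fval /= natrD !natrM addf_div.
Qed.

Lemma fval_sum (r : seq frac) : fval (frac_sum r) = \sum_(q <- r) fval q.
Proof.
have h p : fval (foldl frac_add p r) = fval p + \sum_(q <- r) fval q.
  elim: r p => [|q r IH] p; first by rewrite big_nil addr0.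
  by rewrite /= IH fval_add big_cons addrA.
by rewrite /frac_sum h {1}/fval /= mul0r add0r.
Qed.

Section Owa.

Variables (K : nat) (w : 'I_K -> rat).
Hypothesis (hw : nonincreasing w) (w1 : \sum_j w j = 1).

Lemma owa_lower (f : 'I_K -> rat) : \sum_j f j <= K%:R * owa w f.
Proof.
have [s hs] := owa_sortable f; rewrite (owaE w hs).
have := chebyshev_sum hw hs; rewrite w1 mul1r; apply: le_trans.
by rewrite (reindex_inj (@perm_inj _ s)).
Qed.

(** The first index enters as a [k] of value 0, since ['I_K] has such an element only for positive
    [K]. *)
Lemma owa_upper (f : 'I_K -> rat) (k : 'I_K) : (forall j, 0 <= f j) -> k = 0%N :> nat ->
  owa w f <= w k * \sum_j f j.
Proof.
move=> f0 k0; have [s hs] := owa_sortable f; rewrite (owaE w hs).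
rewrite [X in _ * X](reindex_inj (@perm_inj _ s)) mulr_sumr; apply: ler_sum => j _.
apply: ler_wpM2r => //; move/nonincreasingP: hw; apply; by rewrite k0.
Qed.

End Owa.

(** Coefficients in [nat] make every polynomial monotone, so a bound on the length of an input
    yields a time bound. *)
Lemma horner_nat_le (p : {poly nat}) (m n : nat) :
  (m <= n)%N -> (p.[m] <= p.[n])%N.
Proof.
move=> mn; rewrite !horner_coef; elim/big_ind2: _ => // [|i _].
  by move=> *; rewrite !ssralg.natrE leq_add.
by rewrite !ssralg.natrE leq_mul //; case: (nat_of_ord i) => // k; rewrite leq_exp2r.
Qed.

Lemma quadratic_poly (a : nat) :
  exists q : {poly nat}, forall n : nat, q.[n] = (a * n.+1 ^ 2)%N.
Proof.
by exists (a%:P * ('X + 1) ^+ 2) => n; rewrite !hornerE !ssralg.natrE addn1.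
Qed.

Theorem corollary2 (P : comb_problem) (hP : polynomially_solvable P) :
  @approximable_within (restrict (@nonincreasing_weights P))
    (fun I => first_weight (sval I) * (nscen (sval I))%:R).
Proof.
case: hP => c [p hc]; have [q hq] := quadratic_poly 3000.
(* On an input of length n, [aggregate] takes at most q(n) units and leaves a word of length at most
   n + q(n), on which [c] then runs. *)
exists (Seq aggregate c), (q + (p \Po ('X + q))).
case=> I hI.
pose row i := [seq scenario_cost i j | j <- enum 'I_(nscen I)].
(* The costs are the very fractions written by [aggregate], so its output is the encoding of [J]
   letter for letter. *)
pose J : input (min_cost P) :=
  @CostInput P (owa_structure I) (fun i => frac_sum (row i)).
have [X [feasX optX] [t [s' e es'] ht]] := hc J.
exists X; split=> //.
- rewrite /returns_within /=; set i := _ ++ _.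
  pose rs := [seq row i | i <- enum 'I_(nelem (owa_structure I))].
  have rs0 : all (fun r => (0 < size r)%N) rs.
    by rewrite all_map; apply/allP => k _ /=; rewrite size_map size_enum_ord nscen_gt0.
  have := runs_aggregate (describe (owa_structure I))
    [seq weight j | j <- enum 'I_(nscen I)] rs0.
  rewrite /= (_ : _ ++ _ = i); last first.
    by rewrite /i /rs (enc_list_map _ row).
  rewrite (_ : rcons _ _ ++ _ = encode J); last first.
    by rewrite /= /rs -map_comp.
  (* All stacks but 0 are empty after [aggregate], so [c] starts from a proper initial store. *)
  rewrite -hq; case=> ta ea hta; exists (ta + t)%N.
    by exists s' => //; rewrite upd_st0; apply: exec_seq ea _; rewrite -upd_st0.
  rewrite hornerD horner_comp hornerD hornerX; apply: leq_add => //.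
  apply: leq_trans ht _; apply: horner_nat_le.
  by apply: leq_trans (exec_size 0 ea) _; rewrite leq_add2l.
move=> Y [feasY _].
pose F X j := total_cost (fun i => fval (@scenario_cost P I i j)) X.
have sumF Z : total_cost (fun i => fval (frac_sum (row i))) Z = \sum_j F Z j.
  rewrite /F /total_cost exchange_big /=; apply: eq_bigr => i _.
  by rewrite fval_sum big_map big_enum.
have F0 Z j : 0 <= F Z j by apply: sumr_ge0 => i _; apply: fval_ge0.
have := owa_upper hI (F0 X) (erefl : Ordinal (nscen_gt0 I) = 0%N :> nat).
move=> /le_trans; apply.
rewrite -mulrA; apply: ler_wpM2l; first exact: fval_ge0.
apply: le_trans (owa_lower hI (weight_sum I) (F Y)).
by rewrite -!sumF; apply: optX.
Qed.
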